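(* For every positive integer $n$ there exists an atomic, downward closed set-system $\mathcal{F}\subseteq 2^{[n]}$ with the property that for any two disjoint members $A,B\in\mathcal{F}$ with $|A|\le|B|$, there is $b\in B$ such that $A\cup\{b\}\in\mathcal{F}$, and such that (i) $|\mathcal{F}|\le 2^{(2+o(1))n\log\log n/\log n}$; (ii) $\mathrm{rk}(\mathcal{F})\le (2+o(1))n/\log n$, where $\log$ denotes the base-2 logarithm and $o(1)$ denotes quantities tending to $0$ as $n\to\infty$.
   Context: Here $[n]=\{1,\dots,n\}$. A system $\mathcal{F}$ of subsets of $[n]$ is called atomic if $\emptyset\in\mathcal{F}$ and $\{a\}\in\mathcal{F}$ for every $a\in[n]$; it is downward closed if $A\in\mathcal{F}$ and $A'\subseteq A$ imply $A'\in\mathcal{F}$. The rank $\mathrm{rk}(\mathcal{F})$ is the size of the largest set in $\mathcal{F}$. *)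

(* Defs.v *)
From HB Require Import structures.
From mathcomp Require Import all_boot all_order all_algebra.
From mathcomp Require Import all_classical all_reals all_analysis.

Set Implicit Arguments.
Unset Strict Implicit.
Unset Printing Implicit Defensive.

Import Order.TTheory GRing.Theory Num.Theory.
Import numFieldNormedType.Exports.

(* The ground set [n] = {1, ..., n} is represented by 'I_n = {0, ..., n - 1}. *)

Definition atomic (n : nat) (F : {set {set 'I_n}}) : Prop :=
  finset.set0 \in F /\ forall a : 'I_n, [set a]%SET \in F.

Definition downward_closed (n : nat) (F : {set {set 'I_n}}) : Prop :=
  forall A A' : {set 'I_n}, A \in F -> A' \subset A -> A' \in F.

(* "Two disjoint members" are read as two distinct disjoint members. The only
   pair A = B that is disjoint is A = B = set0, for which no b in B exists. *)
Definition exchange_property (n : nat) (F : {set {set 'I_n}}) : Prop :=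
  forall A B : {set 'I_n}, A \in F -> B \in F -> A != B ->
    [disjoint A & B] -> (#|A| <= #|B|)%N ->
    exists2 b : 'I_n, b \in B & (A :|: [set b])%SET \in F.

Definition rk (n : nat) (F : {set {set 'I_n}}) : nat := \max_(A in F) #|A|.

Definition log2 (R : realType) (x : R) : R := (ln x / ln 2)%R.

(* Main.v *)
(* Cut [n] into blocks V_j of size s and let F consist of the sets A such that,
   for 2 <= t <= s, at most 2^(s-t) blocks meet A in t or more points. Write
   x_j = |A cap V_j|, y_j = |B cap V_j|, N_t = #{j : x_j >= t}. If no b in B can
   be added to A, then for every block j in S = supp y the level x_j + 1 >= 2 is
   saturated: N_(x_j + 1) = 2^(s - x_j - 1). With u = min_S x this gives
   |A| >= u |S| + 2^(s-u), whereas |B| <= u |S| + sum_(t > u) 2^(s-t)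
   = u |S| + 2^(s-u) - 1, so |B| < |A|.
   The rank is at most n/s + 1 + 2^(s-1), and comparing with
   (1 + 1/s)^n = sum_A s^(-|A|) gives |F| <= s^rk (1 + 1/s)^n <= s^rk e^(n/s).
   Taking s about (3/4) log n makes both bounds hold with eps1 = eps2 = 0 once
   n >= 2^64; for smaller n the full power set and large eps1, eps2 do. *)
Require Import Defs.
From HB Require Import structures.
From mathcomp Require Import all_boot all_order all_algebra.
From mathcomp Require Import all_classical all_reals all_analysis.
From mathcomp Require Import zify ring lra.

Set Implicit Arguments.
Unset Strict Implicit.
Unset Printing Implicit Defensive.

Import Order.TTheory GRing.Theory Num.Theory.
Import numFieldNormedType.Exports.

Lemma larger_set_neq0 (T : finType) (A B : {set T}) :
  A != B -> #|A| <= #|B| -> exists b, b \in B.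
Proof.
move=> AB leAB; apply/finset.set0Pn; apply: contraNneq AB => B0.
by move: leAB; rewrite B0 cards0 leqn0 cards_eq0.
Qed.

(** * Level counts and geometric sums *)

Definition nlevel (I : finType) (x : I -> nat) (t : nat) : nat :=
  #|[pred j | t <= x j]|.

(** Double counting of the pairs [(j, t)] with [t < x j]: those with [t < u] are kept per block, the
    others are grouped by level. *)
Lemma sum_nlevel (I : finType) (x : I -> nat) (u s : nat) :
  u <= s -> (forall j, x j <= s) ->
  \sum_j x j = \sum_j minn (x j) u + \sum_(u <= t < s) nlevel x t.+1.
Proof.
move=> us xs.
have -> : \sum_(u <= t < s) nlevel x t.+1 =
          \sum_j \sum_(u <= t < s) (t < x j).
  rewrite exchange_big /=; apply: eq_bigr => t _.
  by rewrite /nlevel -sum1_card big_mkcond /=; apply: eq_bigr => j _;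
  rewrite inE; case: (t < x j).
rewrite -big_split /=; apply: eq_bigr => j _.
have H d : \sum_(u <= t < u + d) (t < x j) = minn (x j) (u + d) - minn (x j) u.
  elim: d => [|d IH]; first by rewrite big_geq ?addn0 ?subnn.
  by rewrite addnS big_nat_recr ?leq_addr //= IH; case: (ltnP (u + d) (x j)); lia.
by have := H (s - u); rewrite subnKC // => ->; have := xs j; lia.
Qed.

(** The unit missing from this geometric sum is what makes [saturated_lt] strict. *)
Lemma sum_pow2 (u s : nat) : u <= s ->
  (\sum_(u <= t < s) 2 ^ (s - t.+1)).+1 = 2 ^ (s - u).
Proof.
move=> us; have H d : d <= s -> (\sum_(s - d <= t < s) 2 ^ (s - t.+1)).+1 = 2 ^ d.
  elim: d => [|d IH] ds; first by rewrite subn0 big_geq.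
  rewrite big_ltn ?ltn_subrL ?(leq_trans _ ds) // -subSn // subSS -addnS IH ?(ltnW ds) //.
  by rewrite subKn ?(ltnW ds) // expnS mul2n addnn.
by have := H (s - u) (leq_subr _ _); rewrite subKn.
Qed.

(** * Comparison of two block profiles when one is saturated on the support of the other *)

Section Exchange.
Variables (I : finType) (s : nat) (x : I -> nat) (S : pred I).
Hypothesis x_le : forall t, 1 < t <= s -> nlevel x t <= 2 ^ (s - t).
Hypothesis x_s : forall j, x j <= s.
Hypothesis x_S : forall j, S j -> x j < s.
Hypothesis saturated : forall j, S j -> nlevel x (x j).+1 = 2 ^ (s - (x j).+1).

(* Downward induction on k: if some j in S has x_j = k, then level k.+1 is
   saturated and N_k <= 2 N_(k.+1), so at most N_(k.+1) blocks have x_j = k. *)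
Lemma saturated_tail (k : nat) : 1 < k <= s ->
  #|[pred j | S j && (k <= x j)]| <= \sum_(k <= t < s) nlevel x t.+1.
Proof.
move=> /andP[k1 ks]; have [d dE] : exists d, d = s - k by exists (s - k).
elim: d => [|d IH] in k k1 ks dE *.
  rewrite eq_card0 // => j; rewrite !inE.
  by apply/negP => /andP[/x_S]; lia.
rewrite big_ltn; last by lia.
have -> : #|[pred j | S j && (k <= x j)]| =
   #|[pred j | S j && (x j == k)]| + #|[pred j | S j && (k < x j)]|.
  rewrite -cardUI [X in _ = _ + X]eq_card0 ?addn0.
    by apply: eq_card => j; rewrite !inE; case: (S j) => //=; lia.
  by move=> j; rewrite !inE; case: (S j) => //=; lia.
apply: leq_add; last by apply: IH; lia.
case: (pickP [pred j | S j && (x j == k)]) => [j /= /andP[Sj /eqP xj]|no].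
  have := saturated Sj; rewrite xj => sat.
  have lek : nlevel x k <= 2 ^ (s - k) by apply: x_le; rewrite k1.
  have : nlevel x k = #|[pred j | x j == k]| + nlevel x k.+1.
    rewrite /nlevel -cardUI [X in _ = _ + X]eq_card0 ?addn0.
      by apply: eq_card => i; rewrite !inE; lia.
    by move=> i; rewrite !inE; lia.
  have : #|[pred j | S j && (x j == k)]| <= #|[pred j | x j == k]|.
    by apply/subset_leq_card/fintype.subsetP => i; rewrite !inE => /andP[].
  have : 2 ^ (s - k) = 2 * 2 ^ (s - k.+1) by rewrite -expnS; congr (2 ^ _); lia.
  by lia.
by rewrite (eq_card0 no).
Qed.

Lemma saturated_lt (y : I -> nat) :
  (forall t, 1 < t <= s -> nlevel y t <= 2 ^ (s - t)) ->
  (forall j, y j <= s) -> (forall j, 0 < y j -> S j) ->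
  (forall j, S j -> 0 < x j) -> (exists j, S j) ->
  \sum_j y j < \sum_j x j.
Proof.
move=> y_le y_s yS x_gt0 [j0 Sj0].
case: (arg_minnP x Sj0) => j1 Sj1; set u := x j1 => u_min.
have u_gt0 : 0 < u by apply: x_gt0.
have us : u < s by apply: x_S.
rewrite (sum_nlevel (ltnW us) y_s) (sum_nlevel (ltnW us) x_s).
have yu : \sum_j minn (y j) u <= \sum_j u * S j.
  apply: leq_sum => j _; have := yS j; case: (S j) => //=; lia.
have yt : \sum_(u <= t < s) nlevel y t.+1 < 2 ^ (s - u).
  rewrite -(sum_pow2 (ltnW us)) ltnS !big_nat; apply: leq_sum => t /andP[ut ts].
  by apply: y_le; lia.
have tail := saturated_tail (k := u.+1) ltac:(lia).
(* A block outside [S] with [x j > u] contributes [u], hence at least 1. *)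
have xu : \sum_j u * S j + #|[pred j | ~~ S j && (u < x j)]| <= \sum_j minn (x j) u.
  rewrite -sum1_card [X in _ + X]big_mkcond -big_split /=; apply: leq_sum => j _.
  have := u_min j; rewrite inE; case: (S j) => /= [/(_ isT) uj|_]; first by lia.
  by case: (ltnP u (x j)); lia.
have split_u : nlevel x u.+1 = #|[pred j | S j && (u < x j)]| + #|[pred j | ~~ S j && (u < x j)]|.
  rewrite /nlevel -cardUI [X in _ = _ + X]eq_card0 ?addn0.
    by apply: eq_card => i; rewrite !inE; case: (S i) => //=; rewrite orbF.
  by move=> i; rewrite !inE; case: (S i); rewrite ?andbF.
have sat : nlevel x u.+1 = 2 ^ (s - u.+1) := saturated Sj1.
have e2 : 2 ^ (s - u) = 2 * 2 ^ (s - u.+1) by rewrite -expnS; congr (2 ^ _); lia.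
(* By [xu], [tail] and [split_u], the blocks with [x j > u], inside or outside [S], supply a second
   copy of [nlevel x u.+1]; the two copies add up to [2 ^ (s - u)]. *)
rewrite [X in _ < _ + X]big_ltn //.
move: yu yt tail xu split_u sat e2.
by lia.
Qed.
End Exchange.

(** * The block system: closure, exchange and rank *)

Section BlockSystem.
Variables (T I : finType) (col : T -> I) (s : nat).
Implicit Types A B : {set T}.

Definition block_card A (j : I) : nat := #|[pred a in A | col a == j]|.

(** Level 1 is left free, so a block that misses [A] never obstructs adding an element. Letting [t]
    range over a finite type makes membership boolean. *)
Definition block_system : {set {set T}} :=
  [set A | [forall t : 'I_s.+1, (1 < t) ==> (nlevel (block_card A) t <= 2 ^ (s - t))]]%SET.

Lemma block_systemP A :
  reflect (forall t, 1 < t <= s -> nlevel (block_card A) t <= 2 ^ (s - t))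
          (A \in block_system).
Proof.
rewrite inE; apply: (iffP forallP) => [H t /andP[t1 ts]|H t].
  by have /implyP /= := H (Ordinal (ts : t < s.+1)); apply.
by apply/implyP => t1; apply: H; rewrite t1 -ltnS ltn_ord.
Qed.

Lemma sum_block_card A : \sum_j block_card A j = #|A|.
Proof.
rewrite -sum1_card (partition_big col predT) //=; apply: eq_bigr => j _.
by rewrite /block_card -sum1_card; apply: eq_bigl => a; rewrite inE.
Qed.

Lemma nlevel_block_card_sub A A' t :
  A' \subset A -> nlevel (block_card A') t <= nlevel (block_card A) t.
Proof.
move=> /fintype.subsetP sub; apply/subset_leq_card/fintype.subsetP => j; rewrite !inE => /leq_trans.
by apply; apply/subset_leq_card/fintype.subsetP => a; rewrite !inE => /andP[/sub -> ->].
Qed.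

Lemma block_system_sub A A' :
  A \in block_system -> A' \subset A -> A' \in block_system.
Proof.
move=> /block_systemP AF sub; apply/block_systemP => t /AF.
exact/leq_trans/nlevel_block_card_sub.
Qed.

Lemma block_system_small A : #|A| <= 1 -> A \in block_system.
Proof.
move=> A1; apply/block_systemP => t /andP[t1 _].
rewrite /nlevel eq_card0 // => j; rewrite !inE; apply/negbTE; rewrite -ltnNge.
by apply: leq_ltn_trans t1; rewrite -(sum_block_card A) (bigD1 j) //= in A1; lia.
Qed.

Hypothesis block_le : forall j, #|[pred a | col a == j]| <= s.

Lemma block_card_le A j : block_card A j <= s.
Proof.
apply: leq_trans (block_le j).
by apply/subset_leq_card/fintype.subsetP => a; rewrite !inE => /andP[].
Qed.

Lemma block_cardU1 A b j : b \notin A ->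
  block_card (A :|: [set b])%SET j = block_card A j + (col b == j).
Proof.
move=> bA; rewrite /block_card (cardD1 b) !inE eqxx orbT /= addnC; congr (_ + _).
apply: eq_card => a; rewrite !inE; case: (eqVneq a b) => [->|_] /=.
  by rewrite (negbTE bA).
by rewrite orbF.
Qed.

(** Adding [b] lifts one block from [v] to [v.+1] points, so only level [v.+1] changes, by at most
    one. The violated bound is therefore at that level and was already attained. *)
Lemma blocked A b : A \in block_system -> b \notin A ->
  (A :|: [set b])%SET \notin block_system ->
  [/\ 0 < block_card A (col b), block_card A (col b) < s &
      nlevel (block_card A) (block_card A (col b)).+1 =
      2 ^ (s - (block_card A (col b)).+1)].
Proof.
move=> /block_systemP AF bA AbF; set v := block_card A (col b).
have vs : v < s.
  have := block_card_le (A :|: [set b])%SET (col b).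
  by rewrite block_cardU1 // eqxx addn1.
have [t /andP[t1 ts] lt_t] : exists2 t, 1 < t <= s &
    2 ^ (s - t) < nlevel (block_card (A :|: [set b])%SET) t.
  move: AbF; rewrite inE negb_forall => /existsP[t]; rewrite negb_imply -ltnNge.
  by case/andP=> t1 lt_t; exists t; rewrite // t1 -ltnS ltn_ord.
have le_t : nlevel (block_card A) t <= 2 ^ (s - t) by apply: AF; rewrite t1.
have vt : t = v.+1.
  apply/eqP; apply: contraTT lt_t => tv; rewrite -leqNgt.
  apply: leq_trans le_t; apply/subset_leq_card/fintype.subsetP => j; rewrite !inE block_cardU1 //.
  by case: eqVneq => [<-|_]; rewrite -/v ?addn1 ?addn0 //; lia.
rewrite vt in t1 ts lt_t le_t; split=> //.
have : nlevel (block_card (A :|: [set b])%SET) v.+1 <= (nlevel (block_card A) v.+1).+1.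
  rewrite {1}/nlevel (cardD1 (col b)) -[X in _ <= X]add1n; apply: leq_add; first exact: leq_b1.
  apply/subset_leq_card/fintype.subsetP => j; rewrite !inE block_cardU1 // => /andP[].
  by rewrite eq_sym => /negbTE ->; rewrite addn0.
by lia.
Qed.

Lemma block_system_exchange A B : A \in block_system -> B \in block_system ->
  A != B -> [disjoint A & B] -> #|A| <= #|B| ->
  exists2 b, b \in B & (A :|: [set b])%SET \in block_system.
Proof.
move=> AF BF AB dAB leAB.
have [b bB] := larger_set_neq0 AB leAB.
apply/exists_inP; apply: contraLR leAB.
rewrite negb_exists_in -ltnNge => /forall_inP noext.
have notA c : c \in B -> c \notin A by move=> cB; rewrite (disjointFl dAB cB).
have S_blocked j : 0 < block_card B j ->
    [/\ 0 < block_card A j, block_card A j < s &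
      nlevel (block_card A) (block_card A j).+1 = 2 ^ (s - (block_card A j).+1)].
  case/card_gt0P => c; rewrite inE => /andP[cB /eqP <-].
  by apply: blocked => //; [exact: notA|exact: noext].
rewrite -!sum_block_card.
(* Here [x] is the profile of [A], [y] that of [B], and [S] consists of the blocks that meet [B]. *)
apply: (@saturated_lt _ s _ [pred j | 0 < block_card B j]) => //=.
- exact/block_systemP.
- exact: block_card_le.
- by move=> j /S_blocked[].
- by move=> j /S_blocked[].
- exact/block_systemP.
- exact: block_card_le.
- by move=> j /S_blocked[].
- by exists (col b); apply/card_gt0P; exists b; rewrite inE bB /=.
Qed.

(** Cutting at level 1 leaves at most one point per block plus the sum of the bounds for levels 2 to
    [s], which is below [2 ^ s.-1]. *)
Lemma card_block_system A : 0 < s -> A \in block_system ->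
  #|A| <= #|I| + 2 ^ s.-1.
Proof.
move=> s0 /block_systemP AF; rewrite -sum_block_card (@sum_nlevel _ _ 1 s) //;
  last exact: block_card_le.
apply: leq_add.
  by rewrite -sum1_card; apply: leq_sum => j _; exact: geq_minr.
rewrite -subn1 -(sum_pow2 s0) leqW // !big_nat; apply: leq_sum => t /andP[t1 ts].
by apply: AF; lia.
Qed.
End BlockSystem.

(** * Counting a family of bounded rank, and the block partition of the ground set *)

Lemma sum_expn_setC (T : finType) (s : nat) :
  \sum_(A : {set T}) s ^ (#|T| - #|A|) = s.+1 ^ #|T|.
Proof.
rewrite -addn1 expnDn (partition_big (fun A : {set T} => inord #|A| : 'I_#|T|.+1) predT) //=.
apply: eq_bigr => i _; rewrite exp1n muln1 -card_draws -sum_nat_const.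
have cardE (A : {set T}) : (inord #|A| == i :> 'I_#|T|.+1) = (#|A| == i).
  by rewrite -val_eqE /= inordK // ltnS max_card.
apply: eq_big => [A|A]; first by rewrite inE cardE.
by rewrite cardE => /eqP ->.
Qed.

(** Weighted counting with denominators cleared: each [A] has weight [s ^ (#|T| - #|A|)], and
    [s ^ r] times the weight of a member of [F] is at least [s ^ #|T|]. *)
Lemma card_small_sets (T : finType) (F : {set {set T}}) (s r : nat) :
  0 < s -> (forall A, A \in F -> #|A| <= r) ->
  #|F| * s ^ #|T| <= s ^ r * s.+1 ^ #|T|.
Proof.
move=> s0 Fr; rewrite -sum_expn_setC -sum_nat_const big_distrr /=.
rewrite [X in _ <= X](bigID (mem F)) /= -[X in X <= _]addn0; apply: leq_add => //.
apply: leq_sum => A /Fr Ar; rewrite -expnD leq_pexp2l //.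
by have := max_card (mem A); lia.
Qed.

Lemma block_family (n s : nat) : 0 < s ->
  exists F : {set {set 'I_n}}, [/\ atomic F, downward_closed F,
    exchange_property F & rk F <= (n %/ s).+1 + 2 ^ s.-1].
Proof.
move=> s0; pose col (a : 'I_n) : 'I_(n %/ s).+1 := inord (a %/ s).
have colE (a : 'I_n) : col a = a %/ s :> nat.
  by rewrite inordK // ltnS leq_div2r // ltnW.
have col_le j : #|[pred a | col a == j]| <= s.
  (* Elements of one block share their quotient by [s], so the remainder separates them. *)
  pose f (a : 'I_n) : 'I_s := Ordinal (ltn_pmod a s0).
  rewrite -[X in _ <= X]card_ord -(@card_in_image _ _ f) ?max_card //.
  move=> a b; rewrite !inE => /eqP aj /eqP bj /(congr1 val) /= ab.
  apply: val_inj; rewrite /= (divn_eq a s) (divn_eq b s) ab.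
  by rewrite -!colE aj bj.
exists (block_system col s); split.
- by split=> [|a]; apply: block_system_small; rewrite ?cards0 ?cards1.
- exact: block_system_sub.
- exact: block_system_exchange.
- by apply/bigmax_leqP => A /(card_block_system col_le s0); rewrite card_ord.
Qed.

Lemma exchange_property_setT (n : nat) : exchange_property [set: {set 'I_n}].
Proof.
move=> A B _ _ AB _ leAB.
have [b bB] := larger_set_neq0 AB leAB.
by exists b; rewrite ?inE.
Qed.

(** Used with [q = k %/ 4], where [k + 1 <= 4 * q + 4]; 11 is the least [q] from which the
    inequality holds. *)
Lemma linear_lt_expn2 (q : nat) : 11 <= q -> 24 * (4 * q + 4) <= 2 ^ q.
Proof.
move=> q11; have [d ->] : exists d, q = 11 + d by exists (q - 11); lia.
by elim: d => [|d IH]; rewrite ?addnS ?(expnS _ (11 + d)) //; lia.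
Qed.

(** * Real estimates for the rank and the number of members *)

Local Open Scope ring_scope.

Lemma ln2_ge_half (R : realType) : 1 / 2 <= ln 2 :> R.
Proof.
have : ln (1 + - (1 / 2)) <= - (1 / 2) :> R by apply: le_ln1Dx; lra.
have -> : 1 + - (1 / 2) = 2^-1 :> R by lra.
by rewrite lnV ?posrE //; lra.
Qed.

Lemma trunc_log_log2 (R : realType) (n : nat) : (0 < n)%N ->
  (trunc_log 2 n)%:R <= log2 (n%:R : R) <= (trunc_log 2 n).+1%:R.
Proof.
move=> n0; have l2 : 0 < ln 2 :> R by rewrite ln_gt0 // ltr1n.
have n0R : (0 : R) < n%:R by rewrite ltr0n.
have lnX k : ln (2 ^ k)%N%:R = k%:R * ln 2 :> R.
  by rewrite natrX lnXn // mulr_natl.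
rewrite /log2 ler_pdivlMr // ler_pdivrMr // -!lnX !ler_ln ?posrE ?ltr0n ?expn_gt0 //.
by rewrite !ler_nat trunc_logP // ltnW // trunc_log_ltn.
Qed.

Section Asymptotics.
Variables (R : realType) (n : nat).
Let k := trunc_log 2 n.
Let s := (k - k %/ 4)%N.
Let L : R := log2 n%:R.
Hypothesis k_ge : (64 <= k)%N.

Let n_gt0 : (0 < n)%N.
Proof. by rewrite lt0n; apply: contraTneq k_ge => n0; rewrite /k n0 trunc_log0. Qed.

Let L_ge : k%:R <= L.
Proof. by have /andP[] := trunc_log_log2 R n_gt0. Qed.

Let L_le : L <= k%:R + 1.
Proof. by have /andP[] := trunc_log_log2 R n_gt0; rewrite [in X in _ -> X]natr1. Qed.

Let k_geR : 64 <= k%:R :> R.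
Proof. by rewrite ler_nat. Qed.

Let s_le : s%:R <= L.
Proof. by apply: le_trans L_ge; rewrite ler_nat leq_subr. Qed.

(** The constant is 65/64 times 4/3: [L <= k + 1 <= 65 / 64 * k] as [k >= 64], and
    [k <= 4 / 3 * s]. *)
Let L_le_s : L <= 65 / 48 * s%:R.
Proof.
have : (3 * k <= 4 * s)%N by rewrite /s; lia.
by rewrite -(ler_nat R) !natrM; have := L_le; have := k_geR; lra.
Qed.

(** After multiplication by [L], the quotient [n / s] costs [65 / 48 * n] and the power [2 ^ s]
    costs at most [n / 24]; together this is [67 / 48 * n], below [3 / 2 * n]. *)
Lemma rank_bound (r : nat) : (r <= (n %/ s).+1 + 2 ^ s.-1)%N ->
  r%:R <= 3 / 2 * (n%:R / L).
Proof.
move=> r_le; have L0 : 0 < L by have := L_ge; have := k_geR; lra.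
have s0 : (0 < s)%N by rewrite /s; lia.
have s0R : 0 < s%:R :> R by rewrite ltr0n.
rewrite mulrA ler_pdivlMr //.
have r_leR : r%:R <= n%:R / s%:R + 2 ^+ s :> R.
  (* Doubling [2 ^ s.-1] absorbs the extra block. *)
  have : (r <= n %/ s + 2 ^ s)%N.
    apply: leq_trans r_le _; rewrite addSnnS leq_add2l.
    have -> : (2 ^ s = 2 * 2 ^ s.-1)%N by rewrite -expnS prednK.
    by have := expn_gt0 2 s.-1; lia.
  rewrite -(ler_nat R) natrD natrX => /le_trans; apply; rewrite lerD2r.
  by rewrite ler_pdivlMr // -natrM ler_nat leq_trunc_div.
(* From [n >= 2 ^ k = 2 ^ s * 2 ^ (k %/ 4)], the second factor dominating [24 * (k + 1)]. *)
have pow_le : 24 * (2 ^+ s * (k%:R + 1)) <= n%:R :> R.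
  rewrite natr1 -natrX -!natrM ler_nat; apply: leq_trans (@trunc_logP 2 n isT n_gt0).
  have -> : trunc_log 2 n = (s + k %/ 4)%N by rewrite -/k /s subnK // leq_div.
  rewrite expnD mulnCA leq_mul2l; apply/orP; right.
  by apply: leq_trans (@linear_lt_expn2 _ _); lia.
have : n%:R / s%:R * L <= 65 / 48 * n%:R.
  rewrite mulrAC ler_pdivrMr // mulrAC [X in _ <= X]mulrC.
  by rewrite ler_wpM2l.
have : 2 ^+ s * L <= 2 ^+ s * (k%:R + 1) by rewrite ler_wpM2l ?exprn_ge0.
have := ler_wpM2r (ltW L0) r_leR; rewrite mulrDl.
by have := ler0n R n; move: pow_le; lra.
Qed.

(** In natural logarithms, [s ^ rk F] costs [3 / 2 * (n / L) * ln L] and [(1 + 1 / s) ^ n] costs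
    [65 / 48 * (n / L)]. Since [ln L >= 3], the latter is at most [1 / 2 * (n / L) * ln L]. *)
Lemma count_bound (F : {set {set 'I_n}}) : (rk F <= (n %/ s).+1 + 2 ^ s.-1)%N ->
  #|F|%:R <= 2 `^ (2 * n%:R * log2 L / L).
Proof.
move=> rF; have L0 : 0 < L by have := L_ge; have := k_geR; lra.
have s0 : (0 < s)%N by rewrite /s; lia.
have s0R : 0 < s%:R :> R by rewrite ltr0n.
have l2 := ln2_ge_half R.
have F_le : #|F|%:R <= s%:R ^+ rk F * (1 + s%:R^-1) ^+ n :> R.
  have : (#|F| * s ^ n <= s ^ rk F * s.+1 ^ n)%N.
    have := @card_small_sets _ F s (rk F) s0; rewrite card_ord; apply=> A.
    exact: (@leq_bigmax_cond _ (mem F) (fun A : {set 'I_n} => #|A|)).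
  rewrite -(ler_nat R) !natrM !natrX -ler_pdivlMr ?exprn_gt0 // => /le_trans; apply.
  rewrite -mulrA ler_wpM2l ?exprn_ge0 // -expr_div_n -natr1 mulrDl divff ?gt_eqF //.
  by rewrite mul1r.
apply: le_trans F_le _.
have -> : 2 `^ (2 * n%:R * log2 L / L) = expR (2 * (n%:R / L) * ln L).
  rewrite /powR gt_eqF // /log2; congr expR.
  by field; rewrite !gt_eqF //; lra.
have -> : s%:R ^+ rk F = expR ((rk F)%:R * ln s%:R) :> R.
  by rewrite mulr_natl -lnXn // lnK // posrE exprn_gt0.
have : (1 + s%:R^-1) ^+ n <= expR (n%:R / s%:R) :> R.
  by rewrite expRM_natl; apply: lerXn2r; rewrite ?nnegrE ?expR_ge0 ?expR_ge1Dx //.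
move=> exp_le; apply: (le_trans (ler_wpM2l (expR_ge0 _) exp_le)); rewrite -expRD ler_expR.
have nL : 0 <= n%:R / L by rewrite divr_ge0 // ltW.
(* [L >= 64] gives [ln L >= 6 * ln 2]. *)
have lnL : 3 <= ln L.
  have : ln (2 ^+ 6) <= ln L.
    by rewrite ler_ln ?posrE ?exprn_gt0 //; have := L_ge; have := k_geR; lra.
  by rewrite lnXn // -(mulr_natl (ln 2)); lra.
have rk_ln : (rk F)%:R * ln s%:R <= 3 / 2 * (n%:R / L) * ln L.
  apply: (@le_trans _ _ ((rk F)%:R * ln L)).
    by rewrite ler_wpM2l // ler_ln ?posrE.
  by rewrite ler_wpM2r ?rank_bound //; lra.
have n_s : n%:R / s%:R <= 65 / 48 * (n%:R / L).
  rewrite ler_pdivrMr // mulrAC [X in _ <= X]mulrA ler_pdivlMr // mulrC.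
  by rewrite ler_wpM2r.
have := ler_wpM2l nL lnL.
by lra.
Qed.
End Asymptotics.

(** * Combining small and large [n] *)

Local Open Scope classical_set_scope.

(* log n vanishes at n = 1 and log log n is positive only from n = 3 on, so the
   bounds are required from the first n at which they make sense. *)
Theorem theorem3 (R : realType) :
  exists eps1 eps2 : nat -> R,
    [/\ eps1 n @[n --> \oo] --> 0,
        eps2 n @[n --> \oo] --> 0 &
        forall n : nat, (0 < n)%N ->
          exists F : {set {set 'I_n}},
            [/\ atomic F,
                downward_closed F,
                exchange_property F,
                (2 < n)%N ->
                  #|F|%:R <=
                  2 `^ ((2 + eps1 n) * n%:R * log2 (log2 n%:R) / log2 n%:R) &
                (1 < n)%N ->
                  (rk F)%:R <= (2 + eps2 n) * n%:R / log2 n%:R]].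
Proof.
pose small (n : nat) := (trunc_log 2 n < 64)%N.
pose L (n : nat) : R := log2 n%:R.
(* For small [n] the error terms alone contribute exactly [n] to the exponent and to the rank bound,
   which suffices for the full power set. Only finitely many [n] are small, so both sequences tend
   to 0. *)
exists (fun n => if small n then L n / log2 (L n) else 0).
exists (fun n => if small n then L n else 0).
have not_small : \forall n \near \oo, small n = false.
  near=> n; apply/negbTE; rewrite -leqNgt; apply: trunc_log_max => //.
  by near: n; exact: nbhs_infty_ge.
have l2 : 0 < ln 2 :> R by rewrite ln_gt0 // ltr1n.
have L_gt0 n : (1 < n)%N -> 0 < L n.
  by move=> n1; rewrite /L /log2 divr_gt0 // ln_gt0 // ltr1n.
split=> [||n n0].
- by apply: cvg_near_cst; apply: filterS not_small => n ->.
- by apply: cvg_near_cst; apply: filterS not_small => n ->.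
have [sm|] := boolP (small n).
  exists [set: {set 'I_n}]%SET; split.
  - by split=> *; rewrite inE.
  - by move=> *; rewrite inE.
  - exact: exchange_property_setT.
  - move=> n2; have Ln := L_gt0 _ (ltnW n2).
    (* [n > 2] gives [L n > 1]. *)
    have lL : 0 < log2 (L n).
      rewrite /log2 divr_gt0 // ln_gt0 // /L /log2 ltr_pdivlMr // mul1r.
      by rewrite ltr_ln ?posrE ?ltr_nat ?ltr0n.
    rewrite -powersetT card_powerset cardsT card_ord natrX -powR_mulrn // ler_powR ?ler1n //.
    rewrite -/(L n) ler_pdivlMr //.
    have -> : (2 + L n / log2 (L n)) * n%:R * log2 (L n) =
       2 * n%:R * log2 (L n) + n%:R * L n.
      by field; rewrite gt_eqF.
    by rewrite lerDr; apply: mulr_ge0 (ltW lL); apply: mulr_ge0.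
  - move=> n1; have Ln := L_gt0 _ n1.
    rewrite -/(L n) ler_pdivlMr //.
    apply: (@le_trans _ _ (n%:R * L n)).
      apply: ler_wpM2r; first exact: ltW.
      rewrite ler_nat; apply/bigmax_leqP => A _.
      by rewrite -[X in (_ <= X)%N]card_ord max_card.
    by rewrite mulrC ler_wpM2r // lerDr.
rewrite /small -leqNgt => big_n.
have [|F [Fa Fd Fe Fr]] := @block_family n (trunc_log 2 n - trunc_log 2 n %/ 4); first by lia.
exists F; split=> // n1; rewrite addr0.
  exact: count_bound.
apply: le_trans (rank_bound R big_n Fr) _; rewrite mulrA ler_wpM2r //.
  by rewrite invr_ge0 ltW ?L_gt0.
by rewrite ler_wpM2r //; lra.
Unshelve. all: by end_near.
Qed.
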